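(* Let $q$ be a prime power, let $k\ge 2$ and $s\ge 0$ be integers and put $N=q^{k-1}+\cdots+q+1$. Let $\beta\in\mu_N$, let $t$ be a fixed integer, and let $L\in\mathbb{F}_{q^k}[x]$ be such that $L(x)^q=\beta x^{-t}L(x)$ for every $x\in\mu_N$. Then the polynomial $x^{s+kN}L(x^{q-1})$ permutes $\mathbb{F}_{q^k}$ if and only if $\gcd(s-t,\,N)=1$, $\gcd(s+kN,\,q-1)=1$, and $L$ has no roots in $\mu_N$.
   Context: $\mu_N=\{x\in\mathbb{F}_{q^k}: x^N=1\}$. A polynomial permutes $\mathbb{F}_{q^k}$ if the induced map $\mathbb{F}_{q^k}\to\mathbb{F}_{q^k}$ is a bijection. *)

(* Defs.v *)
From mathcomp Require Import all_boot all_order all_fingroup all_algebra all_field.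

Set Implicit Arguments.
Unset Strict Implicit.
Unset Printing Implicit Defensive.

Import GRing.Theory.
Local Open Scope ring_scope.

Definition prime_power (q : nat) : Prop :=
  exists p e : nat, [/\ prime p, (0 < e)%N & q = (p ^ e)%N].

Definition mu (F : finFieldType) (N : nat) : {set F} :=
  [set x : F | x ^+ N == 1].

Definition permutes (F : finFieldType) (f : {poly F}) : Prop :=
  bijective (fun x : F => f.[x]).

(* Main.v *)
Require Import Defs.
From mathcomp Require Import all_boot all_order all_fingroup all_algebra all_field.
From mathcomp Require Import cyclic.

Set Implicit Arguments.
Unset Strict Implicit.
Unset Printing Implicit Defensive.

Import GRing.Theory.
Local Open Scope ring_scope.

(** Write r = s + kN and f(x) = x^r L(x^(q-1)).  For x <> 0 the element
    y = x^(q-1) runs over mu_N, and if L(y) <> 0 the hypothesis on L gives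
    f(x)^(q-1) = beta y^(s-t).  Hence f permutes the fibres of x |-> x^(q-1)
    according to y |-> beta y^(s-t), a bijection of mu_N iff
    gcd(s-t, N) = 1; a fibre is a coset of F_q^*, on which f acts through
    b |-> b^r, which is injective iff gcd(r, q-1) = 1. *)

Lemma expf_card_pred (F : finFieldType) (x : F) : x != 0 -> x ^+ #|F|.-1 = 1.
Proof.
move=> x0; apply: (mulfI x0).
by rewrite -exprS prednK ?expf_card ?mulr1 // (cardD1 x).
Qed.

Lemma unity_root_neq0 (F : fieldType) (n : nat) (c : F) :
  (0 < n)%N -> c ^+ n = 1 -> c != 0.
Proof.
move=> n_gt0; apply: contra_eq_neq => ->.
by rewrite expr0n gtn_eqF // eq_sym oner_eq0.
Qed.

(** The nonzero elements are [#|F|.-1] distinct roots of unity of that order, which forces one of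
    them to be primitive. *)
Lemma finField_prim_root (F : finFieldType) :
  exists g : F, #|F|.-1.-primitive_root g.
Proof.
have /hasP[g _ gP] : has #|F|.-1.-primitive_root (enum [set~ (0 : F)]).
  apply: has_prim_root; last by rewrite -cardE cardsC1.
  - by rewrite -ltnS prednK ?finNzRing_gt1 // (cardD1 (0 : F)).
  - apply/allP=> x; rewrite mem_enum !inE => x0.
    by rewrite unity_rootE expf_card_pred.
  - exact: enum_uniq.
by exists g.
Qed.

Lemma finField_prim_root_dvd (F : finFieldType) (d : nat) :
  (d %| #|F|.-1)%N -> exists g : F, d.-primitive_root g.
Proof.
have [g gP] := finField_prim_root F => dP.
by exists (g ^+ (#|F|.-1 %/ d)); apply: dvdn_prim_root.
Qed.

(** For a generator g and x = g^i, the equation x^a = 1 means ab | ia, hence b | i. With a = N and b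
    = q-1 this makes x |-> x^(q-1) surjective onto mu_N. *)
Lemma finField_unity_root_exp (F : finFieldType) (a b : nat) (x : F) :
  #|F|.-1 = (a * b)%N -> x ^+ a = 1 -> exists2 z : F, z != 0 & x = z ^+ b.
Proof.
have [g gP] := finField_prim_root F => cardF xa.
have n_gt0 := prim_order_gt0 gP.
have a_gt0 : (0 < a)%N by move: n_gt0; rewrite cardF muln_gt0 => /andP[].
have xn : x ^+ #|F|.-1 = 1 by rewrite cardF exprM xa expr1n.
have [i xE] := prim_rootP gP xn.
have b_i : (b %| i)%N.
  rewrite -(dvdn_pmul2l a_gt0) -cardF (prim_order_dvd gP) mulnC exprM -xE.
  by rewrite xa.
exists (g ^+ (i %/ b)); last by rewrite xE -exprM divnK.
by rewrite expf_neq0 // (unity_root_neq0 n_gt0 (prim_expr_order gP)).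
Qed.

(** Bezout: if um + vn = 1 then c = c^(um) c^(vn) and the second factor is 1. Exponents are integers
    because u and s-t may be negative. *)
Lemma expf_coprimez_root (F : fieldType) (m n : int) (c : F) :
  gcdz m n = 1 -> c != 0 -> c ^ n = 1 -> exists u : int, c = (c ^ u) ^ m.
Proof.
move=> mn1 c0 cn; have [u [v uv]] := Bezoutz m n.
exists u; rewrite -[LHS]expr1z -mn1 -uv expfzDr // [v * n]mulrC -!exprz_exp.
by rewrite cn exp1rz mulr1.
Qed.

Lemma expf_coprimez_eq1 (F : fieldType) (m n : int) (c : F) :
  gcdz m n = 1 -> c != 0 -> c ^ m = 1 -> c ^ n = 1 -> c = 1.
Proof.
move=> mn1 c0 cm /(expf_coprimez_root mn1 c0)[u ->].
by rewrite exprzAC cm exp1rz.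
Qed.

Theorem theorem4p2 (q k s N : nat) (t : int) (F : finFieldType)
    (beta : F) (L : {poly F})
    (hq : prime_power q) (hk : (2 <= k)%N)
    (hF : #|F| = (q ^ k)%N)
    (hN : N = (\sum_(i < k) q ^ i)%N)
    (hbeta : beta \in mu F N)
    (hL : forall x : F, x \in mu F N -> L.[x] ^+ q = beta * x ^ (- t) * L.[x]) :
  permutes ('X^(s + k * N) * (L \Po 'X^(q - 1))) <->
  [/\ gcdz (s%:Z - t) N%:Z = 1,
      gcdn (s + k * N) (q - 1) = 1%N
    & forall x : F, x \in mu F N -> ~~ root L x].
Proof.
have q_gt1 : (1 < q)%N.
  case: hq => p [e [p_pr e_gt0 ->]].
  by rewrite (leq_trans (prime_gt1 p_pr)) // -{1}[p]expn1 leq_exp2l ?prime_gt1.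
have cardF : #|F|.-1 = (N * (q - 1))%N by rewrite hF hN predn_exp mulnC subn1.
have N_gt0 : (0 < N)%N by rewrite hN (bigD1 (Ordinal (ltnW hk))) /= ?expn0.
have q1_gt0 : (0 < q - 1)%N by rewrite subn_gt0.
set r := (s + k * N)%N.
have r_gt0 : (0 < r)%N by rewrite addn_gt0 muln_gt0 N_gt0 (ltnW hk) orbT.
set f := 'X^r * _.
have fE x : f.[x] = x ^+ r * L.[x ^+ (q - 1)].
  by rewrite hornerM horner_comp !hornerXn.
have f0 : f.[0] = 0 by rewrite fE expr0n gtn_eqF ?mul0r.
have powP (x : F) : x != 0 -> x ^+ (q - 1) \in mu F N.
  by move=> x0; rewrite inE -exprM mulnC -cardF expf_card_pred.
have muE y : y \in mu F N -> exists2 x, x != 0 & y = x ^+ (q - 1).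
  by rewrite inE => /eqP; apply: finField_unity_root_exp.
have mu_neq0 y : y \in mu F N -> y != 0.
  by rewrite inE => /eqP; apply: unity_root_neq0.
have mu1 : 1 \in mu F N by rewrite inE expr1n.
have beta0 : beta != 0 := mu_neq0 _ hbeta.
have f_pow (x : F) : x != 0 -> L.[x ^+ (q - 1)] != 0 ->
    f.[x] ^+ (q - 1) = beta * (x ^+ (q - 1)) ^ (s%:Z - t).
  move=> x0; have := powP x x0; have := mu_neq0 _ (powP x x0).
  rewrite fE exprMn exprAC; move: (x ^+ (q - 1)) => y y0 ymu Ly0.
  (* Cancel one factor L(y) in the hypothesis on L. *)
  have -> : L.[y] ^+ (q - 1) = beta * y ^ (- t).
    by apply: (mulIf Ly0); rewrite -hL // -exprSr subn1 prednK // ltnW.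
  have -> : y ^+ r = y ^ s.
    move: ymu; rewrite inE => /eqP yN.
    by rewrite exprD mulnC exprM yN expr1n mulr1.
  by rewrite mulrCA -expfzDr.
have fiberP (x x' : F) : x != 0 -> x ^+ (q - 1) = x' ^+ (q - 1) ->
    exists2 c, c ^+ (q - 1) = 1 & x' = c * x.
  move=> x0 xx'; exists (x' / x); last by rewrite divfK.
  by rewrite expr_div_n -xx' divff // expf_neq0.
have f_scale (c x : F) : c ^+ (q - 1) = 1 -> f.[c * x] = c ^+ r * f.[x].
  by move=> c1; rewrite !fE !exprMn c1 mul1r mulrA.
split.
- move=> /bij_inj f_inj.
  (* A root y = x^(q-1) of L would give f(x) = 0 = f(0) with x nonzero. *)
  have L_neq0 y : y \in mu F N -> L.[y] != 0.
    move=> /muE[x x0 ->]; apply: contra_neq x0 => Lx.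
    by apply: f_inj; rewrite f0 fE Lx mulr0.
  have r_coprime : gcdn r (q - 1) = 1%N.
    (* An element g of order gcd(r, q-1) satisfies f(g) = g^r f(1) = f(1), so g = 1 and the order is
       1. *)
    have [|g gP] := @finField_prim_root_dvd F (gcdn r (q - 1)).
      by rewrite cardF dvdn_mull // dvdn_gcdr.
    have gr : g ^+ r = 1 by apply/eqP; rewrite -(prim_order_dvd gP) dvdn_gcdl.
    have gq : g ^+ (q - 1) = 1.
      by apply/eqP; rewrite -(prim_order_dvd gP) dvdn_gcdr.
    have g1 : g = 1 by apply: f_inj; rewrite -[g]mulr1 f_scale // gr mul1r.
    by apply/eqP; rewrite -dvdn1 (prim_order_dvd gP) g1.
  split=> //.
  (* An element w of order e lies in mu_N and in the kernel of y |-> y^(s-t); injectivity of f will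
     force w = 1. *)
  pose e := gcdn `|s%:Z - t|%N N.
  have [|w wP] := @finField_prim_root_dvd F e.
    by rewrite cardF dvdn_mulr // dvdn_gcdr.
  have wN : w \in mu F N by rewrite inE -(prim_order_dvd wP) dvdn_gcdr.
  have wst : w ^ (s%:Z - t) = 1.
    have we : w ^+ `|s%:Z - t| = 1.
      by apply/eqP; rewrite -(prim_order_dvd wP) dvdn_gcdl.
    rewrite [X in w ^ X]intEsign mulrC -exprz_exp -exprnP we.
    by rewrite exp1rz.
  have [z z0 wE] := muE w wN.
  have f1_neq0 : f.[1] != 0 by rewrite fE !expr1n mul1r L_neq0.
  (* f(z) and f(1) lie in the same fibre, and gcd(r, q-1) = 1 makes f map the
     fibre of 1 onto that of f(1). *)
  have [|c c1 fz] := fiberP f.[1] f.[z] f1_neq0.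
    by rewrite !f_pow ?oner_eq0 -?wE ?expr1n ?L_neq0 // wst exp1rz.
  have rq1 : gcdz r (q - 1)%N = 1 by rewrite /gcdz !absz_nat r_coprime.
  have [u cu] := expf_coprimez_root rq1 (unity_root_neq0 q1_gt0 c1) c1.
  have cu1 : (c ^ u) ^+ (q - 1) = 1 by rewrite exprnP exprzAC -exprnP c1 exp1rz.
  have zE : z = c ^ u * 1 by apply: f_inj; rewrite f_scale // fz {1}cu.
  (* Now z = c^u is itself in the fibre of 1, so w = z^(q-1) = 1. *)
  have w1 : w = 1 by rewrite wE zE mulr1.
  have e1 : (e %| 1)%N by rewrite (prim_order_dvd wP) w1.
  by rewrite /gcdz absz_nat -/e (eqP (_ : e == 1%N)) // -dvdn1.
- case=> st_coprime r_coprime L_noroot; apply: injF_bij => x x' fxx'.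
  have L_neq0 z : z != 0 -> L.[z ^+ (q - 1)] != 0.
    by move=> z0; have := L_noroot _ (powP z z0).
  have f_neq0 z : (f.[z] == 0) = (z == 0).
    have [->|z0] := eqVneq z 0; first by rewrite f0 eqxx.
    by rewrite fE mulf_eq0 (negbTE (L_neq0 z z0)) orbF expf_eq0 r_gt0
      (negbTE z0).
  have [x0|x0] := eqVneq x 0.
    by move/eqP: fxx'; rewrite x0 f0 eq_sym f_neq0 => /eqP.
  have x'0 : x' != 0 by rewrite -f_neq0 -fxx' f_neq0.
  have yy' : x ^+ (q - 1) = x' ^+ (q - 1).
    have := congr1 (fun a => a ^+ (q - 1)) fxx'; rewrite /= !f_pow ?L_neq0 //.
    move=> /(mulfI beta0).
    have := powP x x0; have := powP x' x'0.
    move: (x ^+ _) (x' ^+ _) => y y' y'mu ymu yy'.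
    have y0 := mu_neq0 y ymu; have y'0 := mu_neq0 y' y'mu.
    (* The quotient of y and y' is killed by both s-t and N, which are coprime. *)
    apply/esym/divr1_eq.
    apply: (expf_coprimez_eq1 st_coprime); first by rewrite mulf_neq0 ?invr_eq0.
      by rewrite expfzMl exprz_inv -invr_expz yy' divff // expfz_neq0.
    move: ymu y'mu; rewrite !inE => /eqP yN /eqP y'N.
    by rewrite -exprnP expr_div_n yN y'N divr1.
  have [c c1 x'E] := fiberP x x' x0 yy'.
  (* Within a fibre, f(x) = f(cx) = c^r f(x) with f(x) nonzero; together with c^(q-1) = 1 this
     leaves only c = 1. *)
  have cr : c ^+ r = 1.
    apply: (@mulIf _ f.[x]); first by rewrite f_neq0.
    by rewrite -f_scale // -x'E -fxx' mul1r.
  rewrite x'E; suff -> : c = 1 by rewrite mul1r.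
  apply: (@expf_coprimez_eq1 _ r (q - 1)%N) => //; last first.
    exact: unity_root_neq0 c1.
  by rewrite /gcdz !absz_nat r_coprime.
Qed.
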